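(* Let $a\in\mathbb{R}$, $a\neq 0$, and let $z=w(x,y)=f_1(x)f_2(y+ax)$ be an affine factorable surface of type 1 in the isotropic space $\mathbb{I}^3$ having constant Gaussian curvature $K_0$. Then, for some $c_1,c_2,c_3\in\mathbb{R}$, one of the following happens: (i) $w(x,y)=c_1 f_2(y+ax)$; (ii) $w(x,y)=c_1 e^{c_2x+c_3(y+ax)}$; (iii) $w(x,y)=c_1 x^{\frac{1}{1-c_2}}(y+ax)^{\frac{c_2}{c_2-1}}$, $c_2\neq 1$; (iv) ($K_0\neq 0$) $w(x,y)=\sqrt{|K_0|}\,x(y+ax)$.
   Context: The 3-dimensional isotropic space $\mathbb{I}^3$ is $\mathbb{R}^3$ with affine coordinates $(x,y,z)$ and the degenerate metric $ds^2=dx^2+dy^2$. An affine factorable surface of type 1 is a graph $z=w(x,y)=f_1(x)f_2(y+ax)$, where $a\neq 0$ is a real constant and $f_1,f_2$ are smooth real-valued functions of one variable, defined on open intervals $I_1,I_2$; the point $(x,y)$ ranges over $\{(x,y): x\in I_1,\ y+ax\in I_2\}$. For a graph $z=w(x,y)$ the (isotropic, or relative) Gaussian curvature is $K=w_{xx}w_{yy}-w_{xy}^2$.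
   Formalization: In (iii) and (iv), x and y+ax are taken up to translation and reflection (±x+b, ±(y+ax)+d), since e.g. w=(x+1)(y+ax) fits no literal case; and (i) also allows w=c1 f1(x), since for constant f2 every f1 gives K0=0. *)

(* Defs.v *)
From Stdlib Require Import Reals ZArith.
From Coquelicot Require Import Coquelicot.
Open Scope R_scope.

Definition ointerval (l r : Rbar) (x : R) : Prop :=
  Rbar_lt l x /\ Rbar_lt x r.

(* Functions on an interval are total functions whose values outside the
   interval are irrelevant; on an open set the derivatives only depend on the
   values inside. *)
Definition smooth_on (I : R -> Prop) (f : R -> R) : Prop :=
  forall (n : nat) (x : R), I x -> ex_derive_n f n x.

Definition factorable1 (a : R) (f1 f2 : R -> R) (x y : R) : R :=
  f1 x * f2 (y + a * x).

Definition factorable1_dom (a : R) (I1 I2 : R -> Prop) (x y : R) : Prop :=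
  I1 x /\ I2 (y + a * x).

(* [partial_derive m k w] differentiates m times in the first variable and
   k times in the second. *)
Definition isotropic_curvature (w : R -> R -> R) (x y : R) : R :=
  partial_derive 2 0 w x y * partial_derive 0 2 w x y
  - (partial_derive 1 1 w x y) ^ 2.

(* [is_rpow t p z]: the real power t^p is defined and equal to z.  The base is
   positive, or the exponent is an integer (negative only if t <> 0).  The two
   clauses agree when both apply. *)
Inductive is_rpow (t p : R) : R -> Prop :=
| is_rpow_pos : 0 < t -> is_rpow t p (Rpower t p)
| is_rpow_int (k : Z) :
    p = IZR k -> t <> 0 \/ (0 <= k)%Z -> is_rpow t p (powerRZ t k).

(* Isometries of the line, t |-> b + t or t |-> b - t.  If phi and psi have
   signs e1, e2, then with a' = e1 * e2 * a one has
     psi (y + a * x) = y' + a' * x',   x' = phi x,   y' = e2 * y + const,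
   so replacing x and y + a * x by phi x and psi (y + a * x) amounts to the
   isometry (x, y, z) |-> (x', y', z) of the isotropic space: a translation
   composed with reflections in the coordinate axes. *)
Definition line_isometry (phi : R -> R) : Prop :=
  exists e b : R, (e = 1 \/ e = -1) /\ forall t, phi t = e * t + b.

(* Main.v *)
Require Import Defs.
From Stdlib Require Import Reals ZArith Lra Lia Ranalysis5 Classical.
From Coquelicot Require Import Coquelicot.
Open Scope R_scope.

(** With u = x and v = y + a x the pair (u, v) ranges over the whole rectangle
    I1 x I2, and the curvature of f(u) g(v) is
      f f''(u) g g''(v) - f'(u)^2 g'(v)^2,
    all terms in a cancelling ([factorable1_curvature]).

    If K0 <> 0, this identity forces f'^2 and g'^2 to be constant, hence f and g
    to be affine ([curved_separation]); this is case (iv).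

    If K0 = 0 and neither function is constant, separating variables gives
    f f'' = k f'^2 and g g'' = (1/k) g'^2 for some k <> 0 ([flat_separation]).
    Where f > 0 these say that f^(1-k) is affine (or, for k = 1, that f is an
    exponential), which gives cases (ii) and (iii) with c2 = k.

    What remains is that f may vanish, and that it is only smooth, so that
    pieces on both sides of a zero could a priori be unrelated.  Two facts
    settle this.  If k >= 1, then log (f^2 + eps) is convex for every eps > 0,
    so a zero of f propagates to the whole interval ([power_ode_zero]).  In
    general f' solves the equation of parameter 2 - 1/k
    ([power_ode_derivative]); on the exponent p = 1/(1-k) of the expected
    solution this is p |-> p - 1.  Lowering p, one reaches after finitely many
    steps either k >= 1 or k = 0, and the latter makes the function affine.
    Hence a nonconstant solution with a zero is c (t - s)^n, with n = p a
    natural number ([power_ode_trichotomy]). *)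

(* [auto_derive] produces the derivatives of eta-expanded functions. *)
Ltac eta_Derive :=
  repeat match goal with
  | |- context [Derive ?F ?t] =>
      match F with
      | fun x => ?g x => progress change (Derive F t) with (Derive g t)
      end
  end.

(** * Calculus on an open interval *)

Lemma ointerval_locally (l r : Rbar) (x : R) :
  ointerval l r x -> locally x (ointerval l r).
Proof.
  intros [h1 h2]; apply (locally_interval _ x l r h1 h2); now split.
Qed.

Lemma ointerval_convex (l r : Rbar) (x y z : R) :
  ointerval l r x -> ointerval l r y -> Rmin x y <= z <= Rmax x y ->
  ointerval l r z.
Proof.
  intros [x1 x2] [y1 y2] [z1 z2]; split.
  - apply Rbar_lt_le_trans with (Finite (Rmin x y)); [| exact z1].
    unfold Rmin; destruct (Rle_dec x y); assumption.
  - apply Rbar_le_lt_trans with (Finite (Rmax x y)); [exact z2 |].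
    unfold Rmax; destruct (Rle_dec x y); assumption.
Qed.

Lemma ointerval_inhabited (l r : Rbar) :
  Rbar_lt l r -> exists x, ointerval l r x.
Proof.
  destruct l as [l | |], r as [r | |]; simpl; intros h; try easy.
  - exists ((l + r) / 2); split; simpl; lra.
  - exists (l + 1); split; simpl; auto; lra.
  - exists (r - 1); split; simpl; auto; lra.
  - exists 0; split; simpl; auto.
Qed.

Lemma mvt_ointerval (l r : Rbar) (f df : R -> R) (x y : R) :
  (forall t, ointerval l r t -> is_derive f t (df t)) ->
  ointerval l r x -> ointerval l r y ->
  exists c, ointerval l r c /\ Rmin x y <= c <= Rmax x y /\
    f y - f x = df c * (y - x).
Proof.
  intros hd hx hy.
  destruct (MVT_gen f x y df) as [c [hc e]].
  - intros t ht; apply hd, (ointerval_convex l r x y); auto; lra.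
  - intros t ht. apply derivable_continuous_pt. exists (df t).
    apply is_derive_Reals, hd, (ointerval_convex l r x y); auto.
  - exists c; repeat split; try tauto; apply (ointerval_convex l r x y); auto.
Qed.

Lemma derive_const_affine (l r : Rbar) (f : R -> R) (A : R) :
  Rbar_lt l r ->
  (forall t, ointerval l r t -> is_derive f t A) ->
  exists B, forall t, ointerval l r t -> f t = A * t + B.
Proof.
  intros h hd; destruct (ointerval_inhabited l r h) as [x hx].
  exists (f x - A * x); intros t ht.
  destruct (mvt_ointerval l r f (fun _ => A) x t hd hx ht) as [c [_ [_ e]]].
  lra.
Qed.

Lemma derive_zero_const (l r : Rbar) (f : R -> R) :
  Rbar_lt l r ->
  (forall t, ointerval l r t -> is_derive f t 0) ->
  exists B, forall t, ointerval l r t -> f t = B.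
Proof.
  intros h hd; destruct (derive_const_affine l r f 0 h hd) as [B hB].
  exists B; intros t ht; rewrite hB; auto; ring.
Qed.

Lemma derive_locally_zero (f : R -> R) (t : R) :
  locally t (fun s => f s = 0) -> locally t (fun s => Derive f s = 0).
Proof.
  intros h; apply locally_locally in h; revert h.
  apply filter_imp; intros s hs.
  rewrite (Derive_ext_loc f (fun _ => 0) s hs); apply Derive_const.
Qed.

Lemma smooth_on_Derive (I : R -> Prop) (f : R -> R) :
  smooth_on I f -> smooth_on I (Derive f).
Proof.
  intros hf [| n] x hx; simpl; auto.
  apply ex_derive_ext with (Derive_n f (S n)).
  - intros t; rewrite <- Nat.add_1_r; symmetry; apply (Derive_n_comp f n 1).
  - exact (hf (S (S n)) x hx).
Qed.

Lemma smooth_on_is_derive (I : R -> Prop) (f : R -> R) (x : R) :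
  smooth_on I f -> I x -> is_derive f x (Derive f x).
Proof. intros hf hx; apply Derive_correct; exact (hf 1%nat x hx). Qed.

Lemma smooth_on_continuous (I : R -> Prop) (f : R -> R) (x : R) :
  smooth_on I f -> I x -> continuous f x.
Proof.
  intros hf hx; apply (ex_derive_continuous (K := R_AbsRing) f x).
  exact (hf 1%nat x hx).
Qed.

Lemma Derive_ext_ointerval (l r : Rbar) (f g : R -> R) (t : R) :
  (forall s, ointerval l r s -> f s = g s) -> ointerval l r t ->
  Derive f t = Derive g t.
Proof.
  intros h ht; apply Derive_ext_loc.
  generalize (ointerval_locally l r t ht); apply filter_imp; auto.
Qed.

(** Near a point where the continuous function E is nonzero, f E = 0 forces
    f = 0; the derivatives of f at that point then vanish too.  This replaces
    division by f at the zeros of f. *)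
Lemma mul_zero_locally_zero (l r : Rbar) (f E : R -> R) (t : R) :
  (forall s, ointerval l r s -> f s * E s = 0) -> ointerval l r t ->
  continuous E t -> E t <> 0 -> locally t (fun s => f s = 0).
Proof.
  intros h ht hc hE.
  pose proof (hc (fun u => u <> 0) (open_neq 0 _ hE)) as h1.
  generalize (filter_and _ _ (ointerval_locally l r t ht) h1).
  apply filter_imp; intros s [hs hs'].
  destruct (Rmult_integral _ _ (h s hs)); [assumption | contradiction].
Qed.

Lemma second_derive_zero_affine (l r : Rbar) (f : R -> R) :
  Rbar_lt l r -> smooth_on (ointerval l r) f ->
  (forall t, ointerval l r t -> Derive (Derive f) t = 0) ->
  exists A B, forall t, ointerval l r t -> Derive f t = A /\ f t = A * t + B.
Proof.
  intros hI hf h.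
  destruct (derive_zero_const l r (Derive f) hI) as [A hA].
  - intros t ht; rewrite <- (h t ht).
    exact (smooth_on_is_derive _ _ t (smooth_on_Derive _ _ hf) ht).
  - destruct (derive_const_affine l r f A hI) as [B hB].
    + intros t ht; rewrite <- (hA t ht); exact (smooth_on_is_derive _ _ t hf ht).
    + exists A, B; auto.
Qed.

(** * The equation f f'' = k f'^2 *)

(** f f'' = k f'^2 on the interval, the equation of t |-> t^p for
    k = 1 - 1/p, and of the exponentials for k = 1. *)
Definition power_ode (k : R) (l r : Rbar) (f : R -> R) : Prop :=
  forall t, ointerval l r t ->
    f t * Derive (Derive f) t = k * Derive f t ^ 2.

(** With E = f' f''' - (2 - 1/k) f''^2, differentiating the equation gives only
    f E = 0; a point where E is nonzero would be in the interior of the zero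
    set of f, where E vanishes. *)
Lemma power_ode_derivative (k : R) (l r : Rbar) (f : R -> R) :
  smooth_on (ointerval l r) f -> k <> 0 -> power_ode k l r f ->
  power_ode (2 - 1 / k) l r (Derive f).
Proof.
  intros hf hk h.
  pose proof (smooth_on_Derive _ _ hf) as hf1.
  pose proof (smooth_on_Derive _ _ hf1) as hf2.
  pose proof (smooth_on_Derive _ _ hf2) as hf3.
  set (f1 := Derive f) in *. set (f2 := Derive f1) in *.
  set (f3 := Derive f2) in *.
  assert (e : forall t, ointerval l r t ->
            f1 t * f2 t + f t * f3 t = k * (2 * f1 t * f2 t)).
  { intros t ht.
    pose proof (smooth_on_is_derive _ _ t hf ht) as d0.
    pose proof (smooth_on_is_derive _ _ t hf1 ht) as d1.
    pose proof (smooth_on_is_derive _ _ t hf2 ht) as d2.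
    fold f1 in d0; fold f2 in d1; fold f3 in d2.
    transitivity (Derive (fun s => f s * f2 s) t).
    - symmetry; apply is_derive_unique.
      auto_derive; [repeat split; eexists; eassumption |].
      eta_Derive; fold f1; fold f3; ring.
    - transitivity (Derive (fun s => k * f1 s ^ 2) t);
        [exact (Derive_ext_ointerval l r _ _ t h ht) |].
      apply is_derive_unique.
      auto_derive; [repeat split; eexists; eassumption |].
      eta_Derive; fold f2; ring. }
  set (E := fun t => f1 t * f3 t - (2 - 1 / k) * f2 t ^ 2).
  assert (hE : forall t, ointerval l r t -> f t * E t = 0).
  { intros t ht; unfold E.
    pose proof (e t ht) as e1; pose proof (h t ht) as e0.
    fold f1 in e0; fold f2 in e0.
    replace (f t * (f1 t * f3 t - (2 - 1 / k) * f2 t ^ 2))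
      with (f1 t * (f t * f3 t) - (2 - 1 / k) * f2 t * (f t * f2 t)) by ring.
    replace (f t * f3 t) with ((2 * k - 1) * f1 t * f2 t) by lra.
    rewrite e0; field; exact hk. }
  intros t ht; fold f2; fold f3.
  apply Rminus_diag_uniq; change (E t = 0).
  destruct (Req_dec (E t) 0) as [| hn]; [assumption | exfalso].
  assert (z : locally t (fun s => f s = 0)).
  { apply (mul_zero_locally_zero l r f E t hE ht); [| exact hn].
    pose proof (smooth_on_is_derive _ _ t hf1 ht) as d1.
    pose proof (smooth_on_is_derive _ _ t hf2 ht) as d2.
    pose proof (smooth_on_is_derive _ _ t hf3 ht) as d3.
    apply (ex_derive_continuous (K := R_AbsRing) E t); unfold E.
    auto_derive; repeat split; eexists; eassumption. }
  apply derive_locally_zero in z.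
  pose proof (locally_singleton _ _ z) as z1; fold f1 in z1.
  apply derive_locally_zero in z; fold f1 in z.
  pose proof (locally_singleton _ _ z) as z2; fold f2 in z2.
  apply hn; unfold E; simpl in z1, z2; rewrite z1, z2; ring.
Qed.

Lemma power_ode_zero (k : R) (l r : Rbar) (f : R -> R) (s t : R) :
  smooth_on (ointerval l r) f -> 1 <= k -> power_ode k l r f ->
  ointerval l r s -> f s = 0 -> ointerval l r t -> f t = 0.
Proof.
  intros hf hk h hs zs ht.
  destruct (Req_dec (f t) 0) as [| hn]; [assumption | exfalso].
  pose proof (smooth_on_Derive _ _ hf) as hf1.
  (* If f t <> 0, the graph of log (f^2 + eps) lies above its tangent at t.
     At s this bounds log eps below by log (f t ^ 2) - C, where C does not
     depend on eps; the eps chosen here violates the bound. *)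
  set (C := Rabs (2 * f t * Derive f t * (t - s)) / f t ^ 2).
  assert (pt : 0 < f t ^ 2) by (apply pow2_gt_0; exact hn).
  set (eps := exp (ln (f t ^ 2) - C - 1)).
  assert (he : 0 < eps) by apply exp_pos.
  set (G := fun u => f u ^ 2 + eps).
  assert (hG : forall u, 0 < G u)
    by (intros u; unfold G; pose proof (pow2_ge_0 (f u)); lra).
  set (L := fun u => 2 * f u * Derive f u / G u).
  set (L' := fun u =>
    (2 * (Derive f u ^ 2 + f u * Derive (Derive f) u) * G u
     - 4 * f u ^ 2 * Derive f u ^ 2) / G u ^ 2).
  assert (dG : forall u, ointerval l r u -> is_derive (fun v => ln (G v)) u (L u)).
  { intros u hu; pose proof (smooth_on_is_derive _ _ u hf hu) as d0.
    pose proof (hG u) as g. unfold L, G in *.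
    auto_derive; [repeat split; [eexists; eassumption | lra] |].
    eta_Derive; field; lra. }
  assert (dL : forall u, ointerval l r u -> is_derive L u (L' u)).
  { intros u hu; pose proof (smooth_on_is_derive _ _ u hf hu) as d0.
    pose proof (smooth_on_is_derive _ _ u hf1 hu) as d1.
    pose proof (hG u) as g. unfold L, L', G in *.
    auto_derive; [repeat split; try (eexists; eassumption); lra |].
    eta_Derive; field; lra. }
  assert (pL : forall u, ointerval l r u -> 0 <= L' u).
  { intros u hu; unfold L'. apply Rdiv_le_0_compat; [| apply pow_lt, hG].
    rewrite (h u hu). unfold G.
    set (p := f u); set (q := Derive f u).
    replace (2 * (q ^ 2 + k * q ^ 2) * (p ^ 2 + eps) - 4 * p ^ 2 * q ^ 2)
      with (2 * (k - 1) * (p * q) ^ 2 + 2 * (1 + k) * eps * q ^ 2) by ring.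
    apply Rplus_le_le_0_compat; (apply Rmult_le_pos; [| apply pow2_ge_0]);
      [| apply Rmult_le_pos]; lra. }
  destruct (mvt_ointerval l r _ L s t dG hs ht) as [c [hc [bc ec]]].
  destruct (mvt_ointerval l r _ L' c t dL hc ht) as [d [hd [_ ed]]].
  assert (b1 : 0 <= (t - c) * (t - s)).
  { revert bc; unfold Rmin, Rmax; destruct (Rle_dec s t); intros; nra. }
  assert (b2 : L c * (t - s) <= L t * (t - s)).
  { pose proof (Rmult_le_pos _ _ (pL d hd) b1). nra. }
  assert (b3 : L t * (t - s) <= C).
  { unfold L, C, Rdiv.
    replace (2 * f t * Derive f t * / G t * (t - s))
      with (2 * f t * Derive f t * (t - s) * / G t) by ring.
    apply Rle_trans with (Rabs (2 * f t * Derive f t * (t - s)) * / G t).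
    - apply Rmult_le_compat_r; [| apply Rle_abs].
      left; apply Rinv_0_lt_compat, hG.
    - apply Rmult_le_compat_l; [apply Rabs_pos |].
      apply Rinv_le_contravar; [exact pt | unfold G; lra]. }
  assert (b4 : ln (G s) = ln (f t ^ 2) - C - 1).
  { unfold G; rewrite zs. replace (0 ^ 2 + eps) with eps by ring.
    apply ln_exp. }
  assert (b5 : ln (f t ^ 2) <= ln (G t)).
  { apply ln_le; [exact pt | unfold G; lra]. }
  lra.
Qed.

Lemma power_ode_zero_exponent (l r : Rbar) (f : R -> R) :
  Rbar_lt l r -> smooth_on (ointerval l r) f -> power_ode 0 l r f ->
  exists A B, forall t, ointerval l r t -> f t = A * t + B.
Proof.
  intros hI hf h.
  pose proof (smooth_on_Derive _ _ (smooth_on_Derive _ _ hf)) as hf2.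
  destruct (second_derive_zero_affine l r f hI hf) as [A [B hAB]].
  - intros t ht; destruct (Req_dec (Derive (Derive f) t) 0) as [| hn];
        [assumption | exfalso; apply hn].
      assert (z : locally t (fun s => f s = 0)).
      { apply (mul_zero_locally_zero l r f (Derive (Derive f)) t); auto.
        - intros s hs; rewrite (h s hs); ring.
        - exact (smooth_on_continuous _ _ t hf2 ht). }
      apply derive_locally_zero, derive_locally_zero in z.
      exact (locally_singleton _ _ z).
  - exists A, B; intros t ht; apply (hAB t ht).
Qed.

(** N bounds the number of times that k can be replaced by 2 - 1/k before it
    leaves the interval (0,1): the hypothesis says that k >= 1 or that the
    exponent 1/(1-k) lies below N. *)
Lemma power_ode_trichotomy_aux (N : nat) (l r : Rbar) :
  Rbar_lt l r -> forall (k : R) (f : R -> R),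
  1 <= k \/ 1 < INR N * (1 - k) ->
  smooth_on (ointerval l r) f -> power_ode k l r f ->
  (exists c, forall t, ointerval l r t -> f t = c)
  \/ (forall t, ointerval l r t -> f t <> 0)
  \/ (exists (n : nat) (c s : R), (1 <= n)%nat /\ k = 1 - 1 / INR n /\
       forall t, ointerval l r t -> f t = c * (t - s) ^ n).
Proof.
  intros hI; induction N as [| N IH]; intros k f hN hf h.
  - assert (hk : 1 <= k) by (simpl in hN; lra).
    destruct (classic (exists s, ointerval l r s /\ f s = 0)) as [[s [hs zs]] | hz].
    + left; exists 0; intros t ht; exact (power_ode_zero k l r f s t hf hk h hs zs ht).
    + right; left; intros t ht e; apply hz; now exists t.
  - destruct (Req_dec k 0) as [k0 | k0].
    { rewrite k0 in h.
      destruct (power_ode_zero_exponent l r f hI hf h) as [A [B hAB]].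
      destruct (Req_dec A 0) as [A0 | A0].
      - left; exists B; intros t ht; rewrite hAB, A0; auto; ring.
      - right; right; exists 1%nat, A, (- B / A); split; [lia | split].
        + simpl; lra.
        + intros t ht; rewrite hAB; auto; field; exact A0. }
    destruct (classic (exists s, ointerval l r s /\ f s = 0)) as [[s [hs zs]] | hz];
      [| right; left; intros t ht e; apply hz; now exists t].
    destruct (Rle_dec 1 k) as [hk | hk].
    { left; exists 0; intros t ht; exact (power_ode_zero k l r f s t hf hk h hs zs ht). }
    assert (zs' : Derive f s = 0).
    { pose proof (h s hs) as e; rewrite zs, Rmult_0_l in e.
      destruct (Rmult_integral _ _ (eq_sym e)) as [| e']; [contradiction |].
      destruct (Req_dec (Derive f s) 0) as [| hn]; [assumption |].
      exfalso; exact (pow_nonzero _ 2 hn e'). }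
    (* For k < 0 the new parameter 2 - 1/k exceeds 1; for 0 < k < 1 the
       exponent drops by one. *)
    destruct (IH (2 - 1 / k) (Derive f)) as [[c hc] | [hn | [n [c [s' [hn [hk' hc]]]]]]].
    + destruct (Rlt_dec k 0) as [neg | pos].
      * left. assert (1 / k < 0) by (apply Rdiv_pos_neg; lra). lra.
      * right. assert (pk : 0 < k) by lra.
        rewrite S_INR in hN.
        replace (INR N * (1 - (2 - 1 / k))) with (INR N * (1 - k) / k)
          by (field; lra).
        apply Rlt_div_r; lra.
    + apply smooth_on_Derive, hf.
    + exact (power_ode_derivative k l r f hf k0 h).
    + left; apply (derive_zero_const l r f hI); intros t ht.
      replace 0 with (Derive f t) by (rewrite <- zs', (hc t ht), (hc s hs); reflexivity).
      apply (smooth_on_is_derive _ _ t hf ht).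
    + exfalso; exact (hn s hs zs').
    + destruct (Req_dec c 0) as [c0 | c0].
      { left; apply (derive_zero_const l r f hI); intros t ht.
        replace 0 with (Derive f t) by (rewrite (hc t ht), c0; ring).
        apply (smooth_on_is_derive _ _ t hf ht). }
      assert (pn : 0 < INR n) by (apply lt_0_INR; lia).
      (* f' vanishes at s and only at s', so f = c (t - s)^(n+1) / (n+1) + B,
         and f s = 0 gives B = 0. *)
      assert (es : s' = s).
      { rewrite (hc s hs) in zs'.
        destruct (Rmult_integral _ _ zs') as [| e]; [contradiction |].
        destruct (Req_dec (s - s') 0) as [| hd]; [lra |].
        exfalso; exact (pow_nonzero _ n hd e). }
      subst s'.
      destruct (derive_zero_const l r
        (fun t => f t - c / INR (S n) * (t - s) ^ S n) hI) as [B hB].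
      { intros t ht. pose proof (smooth_on_is_derive _ _ t hf ht) as d.
        auto_derive; [eexists; eassumption |]; eta_Derive.
        change (match n with O => 1 | S _ => INR n + 1 end) with (INR (S n)).
        change (t + - s) with (t - s); simpl pred.
        rewrite (hc t ht), S_INR; field; lra. }
      assert (B0 : B = 0).
      { rewrite <- (hB s hs), zs; simpl; ring. }
      right; right; exists (S n), (c / INR (S n)), s; split; [lia | split].
      * rewrite S_INR.
        assert (e : 1 / k = 1 + 1 / INR n) by lra.
        replace k with (1 / (1 / k)) by (field; exact k0).
        rewrite e; field; lra.
      * intros t ht; pose proof (hB t ht); lra.
Qed.

Lemma power_ode_trichotomy (k : R) (l r : Rbar) (f : R -> R) :
  Rbar_lt l r -> smooth_on (ointerval l r) f -> power_ode k l r f ->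
  (exists c, forall t, ointerval l r t -> f t = c)
  \/ (forall t, ointerval l r t -> f t <> 0)
  \/ (exists (n : nat) (c s : R), (1 <= n)%nat /\ k = 1 - 1 / INR n /\
       forall t, ointerval l r t -> f t = c * (t - s) ^ n).
Proof.
  intros hI hf h.
  destruct (Rle_dec 1 k) as [hk | hk].
  - apply (power_ode_trichotomy_aux 0 l r hI); auto.
  - assert (pk : 0 < 1 - k) by lra.
    destruct (INR_unbounded (1 / (1 - k))) as [N hN].
    apply (power_ode_trichotomy_aux N l r hI); auto.
    right; apply Rlt_div_l in hN; lra.
Qed.

Lemma nonzero_constant_sign (l r : Rbar) (f : R -> R) :
  Rbar_lt l r -> smooth_on (ointerval l r) f ->
  (forall t, ointerval l r t -> f t <> 0) ->
  exists e, (e = 1 \/ e = -1) /\ forall t, ointerval l r t -> 0 < e * f t.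
Proof.
  intros hI hf hn.
  assert (hc : forall t, ointerval l r t -> continuity_pt f t).
  { intros t ht; apply continuity_pt_filterlim.
    exact (smooth_on_continuous _ _ t hf ht). }
  assert (key : forall x y, ointerval l r x -> ointerval l r y ->
                  f x < 0 -> 0 < f y -> False).
  { intros x y hx hy fx fy.
    destruct (Rtotal_order x y) as [c | [c | c]]; [| subst; lra |].
    - destruct (IVT_interv f x y) as [z [hz e]]; auto.
      + intros u hu; apply hc, (ointerval_convex l r x y); auto.
        rewrite Rmin_left, Rmax_right; lra.
      + apply (hn z); auto; apply (ointerval_convex l r x y); auto.
        rewrite Rmin_left, Rmax_right; lra.
    - destruct (IVT_interv (fun u => - f u) y x) as [z [hz e]]; auto; try lra.
      + intros u hu; apply continuity_pt_opp, hc, (ointerval_convex l r x y); auto.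
        rewrite Rmin_right, Rmax_left; lra.
      + apply (hn z); [| lra]; apply (ointerval_convex l r x y); auto.
        rewrite Rmin_right, Rmax_left; lra. }
  destruct (ointerval_inhabited l r hI) as [x hx].
  destruct (Rtotal_order (f x) 0) as [c | [c | c]].
  - exists (-1); split; [now right |]; intros t ht.
    destruct (Rtotal_order (f t) 0) as [d | [d | d]]; [lra | |].
    + now elim (hn t ht).
    + now elim (key x t).
  - now elim (hn x hx).
  - exists 1; split; [now left |]; intros t ht.
    destruct (Rtotal_order (f t) 0) as [d | [d | d]]; [| | lra].
    + now elim (key t x).
    + now elim (hn t ht).
Qed.

(** (e f)^(-k) f' is constant; e is the sign of f. *)
Lemma power_ode_first_integral (k e : R) (l r : Rbar) (f : R -> R) :
  Rbar_lt l r -> smooth_on (ointerval l r) f -> power_ode k l r f ->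
  (forall t, ointerval l r t -> 0 < e * f t) ->
  exists al, forall t, ointerval l r t ->
    Derive f t = al * exp (k * ln (e * f t)).
Proof.
  intros hI hf h hp.
  pose proof (smooth_on_Derive _ _ hf) as hf1.
  destruct (derive_zero_const l r
    (fun t => Derive f t * exp (- k * ln (e * f t))) hI) as [al hal].
  - intros t ht; pose proof (hp t ht) as p.
    assert (f0 : f t <> 0) by (intros z; rewrite z in p; lra).
    assert (e0 : e <> 0) by (intros z; rewrite z in p; lra).
    pose proof (smooth_on_is_derive _ _ t hf ht) as d0.
    pose proof (smooth_on_is_derive _ _ t hf1 ht) as d1.
    auto_derive; [repeat split; try (eexists; eassumption); exact p |].
    eta_Derive.
    replace (Derive (Derive f) t) with (k * Derive f t ^ 2 / f t)
      by (rewrite <- (h t ht); field; exact f0).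
    field; auto.
  - exists al; intros t ht; rewrite <- (hal t ht), Rmult_assoc, <- exp_plus.
    replace (- k * ln (e * f t) + k * ln (e * f t)) with 0 by ring.
    rewrite exp_0; ring.
Qed.

Lemma power_ode_exp (l r : Rbar) (f : R -> R) :
  Rbar_lt l r -> smooth_on (ointerval l r) f -> power_ode 1 l r f ->
  exists c al, forall t, ointerval l r t -> f t = c * exp (al * t).
Proof.
  intros hI hf h.
  destruct (power_ode_trichotomy 1 l r f hI hf h)
    as [[c hc] | [hn | [n [c [s [hn [hk _]]]]]]].
  - exists c, 0; intros t ht; rewrite Rmult_0_l, exp_0, hc; auto; ring.
  - destruct (nonzero_constant_sign l r f hI hf hn) as [e [_ hp]].
    destruct (power_ode_first_integral 1 e l r f hI hf h hp) as [al hal].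
    destruct (derive_zero_const l r (fun t => f t * exp (- (al * e) * t)) hI)
      as [c hc].
    + intros t ht; pose proof (smooth_on_is_derive _ _ t hf ht) as d.
      auto_derive; [eexists; eassumption |]; eta_Derive.
      rewrite (hal t ht), (Rmult_1_l (ln _)), (exp_ln _ (hp t ht)); ring.
    + exists c, (al * e); intros t ht.
      rewrite <- (hc t ht), Rmult_assoc, <- exp_plus.
      replace (- (al * e) * t + al * e * t) with 0 by ring.
      rewrite exp_0; ring.
  - exfalso; assert (pn : 0 < INR n) by (apply lt_0_INR; lia).
    assert (0 < 1 / INR n) by (apply Rdiv_lt_0_compat; lra). lra.
Qed.

(** For k <> 1 a nonconstant solution is a multiple of a power of exponent
    1/(1-k), up to an isometry of the line.  Either the exponent is a natural
    number and the base may have any sign, or the base is positive. *)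
Lemma power_ode_rpow (k : R) (l r : Rbar) (f : R -> R) :
  Rbar_lt l r -> smooth_on (ointerval l r) f -> power_ode k l r f -> k <> 1 ->
  (exists c, forall t, ointerval l r t -> f t = c)
  \/ exists (c : R) (phi : R -> R), line_isometry phi /\
       forall t, ointerval l r t ->
       exists p, is_rpow (phi t) (1 / (1 - k)) p /\ f t = c * p.
Proof.
  intros hI hf h hk.
  destruct (power_ode_trichotomy k l r f hI hf h)
    as [[c hc] | [hn | [n [c [s [hn [hk' hc]]]]]]].
  - left; now exists c.
  - destruct (nonzero_constant_sign l r f hI hf hn) as [e [he hp]].
    destruct (power_ode_first_integral k e l r f hI hf h hp) as [al hal].
    destruct (derive_const_affine l r (fun t => exp ((1 - k) * ln (e * f t)))
      ((1 - k) * al * e) hI) as [B hB].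
    (* (e f)^(1-k) is affine. *)
    { intros t ht; pose proof (hp t ht) as p.
      pose proof (smooth_on_is_derive _ _ t hf ht) as d.
      auto_derive; [split; [eexists; eassumption | split; auto] |]; eta_Derive.
      assert (E : exp (k * ln (e * f t)) * exp ((1 - k) * ln (e * f t)) = e * f t).
      { rewrite <- exp_plus.
        replace (k * ln (e * f t) + (1 - k) * ln (e * f t))
          with (ln (e * f t)) by ring.
        now apply exp_ln. }
      rewrite (hal t ht).
      transitivity ((1 - k) * al * (e / (e * f t)) *
        (exp (k * ln (e * f t)) * exp ((1 - k) * ln (e * f t)))).
      - field; split; intros z; rewrite z in p; lra.
      - rewrite E; field; split; intros z; rewrite z in p; lra. }
    set (A := (1 - k) * al * e) in *.
    assert (hs : forall t, ointerval l r t ->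
              0 < A * t + B /\ f t = e * Rpower (A * t + B) (1 / (1 - k))).
    { intros t ht; rewrite <- (hB t ht); split; [apply exp_pos |].
      unfold Rpower; rewrite ln_exp.
      replace (1 / (1 - k) * ((1 - k) * ln (e * f t))) with (ln (e * f t))
        by (field; lra).
      rewrite (exp_ln _ (hp t ht)); destruct he; subst e; ring. }
    destruct (Req_dec A 0) as [A0 | A0].
    { left; exists (e * Rpower B (1 / (1 - k))); intros t ht.
      destruct (hs t ht) as [_ ->]; do 2 f_equal; rewrite A0; ring. }
    (* A line isometry has slope 1 or -1, so |A| goes into the constant. *)
    right; exists (e * Rpower (Rabs A) (1 / (1 - k))),
      (fun t => A / Rabs A * t + B / Rabs A).
    assert (pA : 0 < Rabs A) by now apply Rabs_pos_lt.
    split.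
    + exists (A / Rabs A), (B / Rabs A); split; [| reflexivity].
      unfold Rabs; destruct (Rcase_abs A); [right | left]; field; lra.
    + intros t ht; destruct (hs t ht) as [p ->].
      exists (Rpower (A / Rabs A * t + B / Rabs A) (1 / (1 - k))).
      assert (p' : 0 < A / Rabs A * t + B / Rabs A).
      { replace (A / Rabs A * t + B / Rabs A) with ((A * t + B) / Rabs A)
          by (field; lra).
        now apply Rdiv_lt_0_compat. }
      split; [now apply is_rpow_pos |].
      rewrite Rmult_assoc, Rpower_mult_distr; auto.
      do 2 f_equal; field; lra.
  - right; exists c, (fun t => 1 * t + - s); split; [exists 1, (- s); auto |].
    intros t ht; exists (powerRZ (1 * t + - s) (Z.of_nat n)); split.
    + apply is_rpow_int; [| right; lia].
      assert (pn : 0 < INR n) by (apply lt_0_INR; lia).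
      rewrite hk', <- INR_IZR_INZ; field; lra.
    + rewrite <- pow_powerRZ, (hc t ht); do 2 f_equal; ring.
Qed.

(** * The curvature equation *)

Lemma factorable1_curvature (a : R) (l1 r1 l2 r2 : Rbar) (f g : R -> R)
  (x y : R) :
  smooth_on (ointerval l1 r1) f -> smooth_on (ointerval l2 r2) g ->
  ointerval l1 r1 x -> ointerval l2 r2 (y + a * x) ->
  isotropic_curvature (factorable1 a f g) x y =
  (f x * Derive (Derive f) x) *
    (g (y + a * x) * Derive (Derive g) (y + a * x))
  - Derive f x ^ 2 * Derive g (y + a * x) ^ 2.
Proof.
  intros hf hg hx hv.
  pose proof (smooth_on_Derive _ _ hf) as hf1.
  pose proof (smooth_on_Derive _ _ hg) as hg1.
  assert (dy : forall k t, Derive_n (fun z => factorable1 a f g t z) k y =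
                 f t * Derive_n g k (y + a * t)).
  { intros k t; unfold factorable1.
    now rewrite Derive_n_scal_l, Derive_n_comp_trans. }
  assert (dx : forall (p q : R -> R) t, smooth_on (ointerval l1 r1) p ->
    smooth_on (ointerval l2 r2) q -> ointerval l1 r1 t ->
    ointerval l2 r2 (y + a * t) ->
    is_derive (fun s => p s * q (y + a * s)) t
      (Derive p t * q (y + a * t) + a * (p t * Derive q (y + a * t)))).
  { intros p q t hp hq ht hu.
    pose proof (smooth_on_is_derive _ _ t hp ht) as d0.
    pose proof (smooth_on_is_derive _ _ _ hq hu) as d1.
    auto_derive; [repeat split; eexists; eassumption |]; eta_Derive; ring. }
  assert (near : locally x (fun t => ointerval l1 r1 t /\ ointerval l2 r2 (y + a * t))).
  { apply filter_and; [now apply ointerval_locally |].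
    apply (ex_derive_continuous (K := R_AbsRing) (fun t => y + a * t) x);
      [auto_derive; auto | now apply ointerval_locally]. }
  assert (w02 : partial_derive 0 2 (factorable1 a f g) x y =
                f x * Derive (Derive g) (y + a * x)) by apply (dy 2%nat).
  assert (w11 : partial_derive 1 1 (factorable1 a f g) x y =
                Derive f x * Derive g (y + a * x)
                + a * (f x * Derive (Derive g) (y + a * x))).
  { unfold partial_derive; rewrite (Derive_n_ext _ _ 1 x (dy 1%nat)).
    apply is_derive_unique, (dx f (Derive g)); auto. }
  assert (w20 : partial_derive 2 0 (factorable1 a f g) x y =
    Derive (Derive f) x * g (y + a * x)
    + 2 * a * (Derive f x * Derive g (y + a * x))
    + a ^ 2 * (f x * Derive (Derive g) (y + a * x))).
  { unfold partial_derive; rewrite (Derive_n_ext _ _ 2 x (dy 0%nat)).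
    change (Derive (Derive (fun s => f s * g (y + a * s))) x =
      Derive (Derive f) x * g (y + a * x)
      + 2 * a * (Derive f x * Derive g (y + a * x))
      + a ^ 2 * (f x * Derive (Derive g) (y + a * x))).
    transitivity (Derive (fun t => Derive f t * g (y + a * t)
                         + a * (f t * Derive g (y + a * t))) x).
    - apply Derive_ext_loc; revert near; apply filter_imp.
      intros t [ht hu]; apply is_derive_unique, dx; auto.
    - apply is_derive_unique.
      pose proof (dx (Derive f) g x hf1 hg hx hv) as d1.
      pose proof (dx f (Derive g) x hf hg1 hx hv) as d2.
      apply (is_derive_scal _ x a) in d2.
      pose proof (is_derive_plus _ _ x _ _ d1 d2) as d.
      match type of d with is_derive _ _ ?u =>
        match goal with |- is_derive _ _ ?v => replace v with u end end.
      + exact d.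
      + unfold plus, mult; simpl; ring. }
  unfold isotropic_curvature; rewrite w02, w11, w20; ring.
Qed.

Lemma derive_sqr_const (l r : Rbar) (f : R -> R) (C : R) :
  Rbar_lt l r -> smooth_on (ointerval l r) f ->
  (forall t, ointerval l r t -> Derive f t ^ 2 = C) ->
  forall t, ointerval l r t -> Derive (Derive f) t = 0.
Proof.
  intros hI hf h t ht.
  pose proof (smooth_on_Derive _ _ hf) as hf1.
  assert (e : forall s, ointerval l r s -> Derive f s * Derive (Derive f) s = 0).
  { intros s hs. pose proof (smooth_on_is_derive _ _ s hf1 hs) as d.
    assert (e : Derive (fun u => Derive f u ^ 2) s = 0).
    { transitivity (Derive (fun _ => C) s); [| apply Derive_const].
      exact (Derive_ext_ointerval l r _ _ s h hs). }
    assert (e' : Derive (fun u => Derive f u ^ 2) s =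
                 2 * (Derive f s * Derive (Derive f) s)).
    { apply is_derive_unique. auto_derive; [eexists; eassumption |].
      eta_Derive; ring. }
    lra. }
  destruct (Req_dec (Derive (Derive f) t) 0) as [| hn]; [assumption | exfalso].
  assert (z : locally t (fun s => Derive f s = 0)).
  { apply (mul_zero_locally_zero l r (Derive f) (Derive (Derive f)) t e ht);
      [| exact hn].
    exact (smooth_on_continuous _ _ t (smooth_on_Derive _ _ hf1) ht). }
  apply hn, (locally_singleton _ _ (derive_locally_zero _ _ z)).
Qed.

(** Freezing one variable at a point where the derivative is nonzero yields the
    equation of the other function. *)
Lemma flat_separation (l1 r1 l2 r2 : Rbar) (f g : R -> R) :
  Rbar_lt l1 r1 -> Rbar_lt l2 r2 ->
  smooth_on (ointerval l1 r1) f -> smooth_on (ointerval l2 r2) g ->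
  (forall u v, ointerval l1 r1 u -> ointerval l2 r2 v ->
     (f u * Derive (Derive f) u) * (g v * Derive (Derive g) v)
     = Derive f u ^ 2 * Derive g v ^ 2) ->
  (exists c, forall u, ointerval l1 r1 u -> f u = c)
  \/ (exists c, forall v, ointerval l2 r2 v -> g v = c)
  \/ exists k, k <> 0 /\ power_ode k l1 r1 f /\ power_ode (1 / k) l2 r2 g.
Proof.
  intros hI1 hI2 hf hg h.
  destruct (classic (exists u, ointerval l1 r1 u /\ Derive f u <> 0))
    as [[u0 [hu0 nu]] | hz].
  2: { left; apply (derive_zero_const _ _ _ hI1); intros u hu.
       destruct (Req_dec (Derive f u) 0) as [<- | hn];
         [exact (smooth_on_is_derive _ _ u hf hu) | elim hz; now exists u]. }
  destruct (classic (exists v, ointerval l2 r2 v /\ Derive g v <> 0))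
    as [[v0 [hv0 nv]] | hz].
  2: { right; left; apply (derive_zero_const _ _ _ hI2); intros v hv.
       destruct (Req_dec (Derive g v) 0) as [<- | hn];
         [exact (smooth_on_is_derive _ _ v hg hv) | elim hz; now exists v]. }
  right; right.
  pose proof (h u0 v0 hu0 hv0) as h00.
  pose proof (fun u hu => h u v0 hu hv0) as hfe.
  pose proof (fun v hv => h u0 v hu0 hv) as hge.
  assert (a2 : Derive f u0 ^ 2 <> 0) by now apply pow_nonzero.
  assert (b2 : Derive g v0 ^ 2 <> 0) by now apply pow_nonzero.
  set (A1 := f u0 * Derive (Derive f) u0) in *.
  set (A2 := Derive f u0 ^ 2) in *.
  set (B1 := g v0 * Derive (Derive g) v0) in *.
  set (B2 := Derive g v0 ^ 2) in *.
  assert (ab : A1 * B1 <> 0) by (rewrite h00; now apply Rmult_integral_contrapositive).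
  assert (a1 : A1 <> 0) by (intros z; apply ab; rewrite z; ring).
  assert (b1 : B1 <> 0) by (intros z; apply ab; rewrite z; ring).
  exists (A1 / A2); repeat split.
  - now apply Rmult_integral_contrapositive; split; [| apply Rinv_neq_0_compat].
  - intros u hu; apply (Rmult_eq_reg_r B1); [| exact b1].
    rewrite (hfe u hu).
    replace (A1 / A2 * Derive f u ^ 2 * B1)
      with (A1 * B1 / A2 * Derive f u ^ 2) by (field; exact a2).
    rewrite h00; field; exact a2.
  - intros v hv; apply (Rmult_eq_reg_l A1); [| exact a1].
    rewrite (hge v hv); field; auto.
Qed.

(** For K <> 0 both squares f'^2 and g'^2 are constant, so f and g are affine. *)
Lemma curved_separation (l1 r1 l2 r2 : Rbar) (f g : R -> R) (K : R) :
  Rbar_lt l1 r1 -> Rbar_lt l2 r2 ->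
  smooth_on (ointerval l1 r1) f -> smooth_on (ointerval l2 r2) g ->
  (forall u v, ointerval l1 r1 u -> ointerval l2 r2 v ->
     (f u * Derive (Derive f) u) * (g v * Derive (Derive g) v)
     - Derive f u ^ 2 * Derive g v ^ 2 = K) ->
  K <> 0 ->
  exists A B C D, - (A * C) ^ 2 = K /\
    (forall u, ointerval l1 r1 u -> f u = A * u + B) /\
    (forall v, ointerval l2 r2 v -> g v = C * v + D).
Proof.
  intros hI1 hI2 hf hg h hK.
  destruct (ointerval_inhabited _ _ hI1) as [u0 hu0].
  destruct (ointerval_inhabited _ _ hI2) as [v0 hv0].
  assert (hf' : forall u, ointerval l1 r1 u -> Derive f u ^ 2 = Derive f u0 ^ 2).
  { intros u hu; apply NNPP; intros ne.
    (* Subtracting the equations at u and u0 gives g'^2 = m g g'', hence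
       (f f'' - m f'^2)(u0) g g'' = K.  So g g'' is a nonzero constant, and g'^2
       is constant, which makes g'' vanish: a contradiction. *)
    set (F := fun s => f s * Derive (Derive f) s).
    set (m := (F u - F u0) / (Derive f u ^ 2 - Derive f u0 ^ 2)).
    assert (nd : Derive f u ^ 2 - Derive f u0 ^ 2 <> 0) by lra.
    assert (e : forall v, ointerval l2 r2 v ->
              Derive g v ^ 2 = m * (g v * Derive (Derive g) v)).
    { intros v hv; pose proof (h u v hu hv) as e1; pose proof (h u0 v hu0 hv) as e0.
      fold (F u) in e1; fold (F u0) in e0; unfold m.
      apply (Rmult_eq_reg_l (Derive f u ^ 2 - Derive f u0 ^ 2)); [| exact nd].
      transitivity ((F u - F u0) * (g v * Derive (Derive g) v)); [lra |].
      field; exact nd. }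
    assert (e' : forall v, ointerval l2 r2 v ->
              (F u0 - Derive f u0 ^ 2 * m) * (g v * Derive (Derive g) v) = K).
    { intros v hv; rewrite <- (h u0 v hu0 hv), (e v hv); unfold F; ring. }
    assert (n0 : F u0 - Derive f u0 ^ 2 * m <> 0).
    { intros z; apply hK; rewrite <- (e' v0 hv0), z; ring. }
    assert (z : Derive (Derive g) v0 = 0).
    { apply (derive_sqr_const l2 r2 g (m * (K / (F u0 - Derive f u0 ^ 2 * m)))
        hI2 hg); [| exact hv0].
      intros v hv; rewrite (e v hv), <- (e' v hv); field; exact n0. }
    apply hK; rewrite <- (e' v0 hv0), z; ring. }
  pose proof (derive_sqr_const _ _ _ _ hI1 hf hf') as zf.
  assert (hg' : forall v, ointerval l2 r2 v ->
            Derive g v ^ 2 = - K / Derive f u0 ^ 2).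
  { intros v hv; pose proof (h u0 v hu0 hv) as e; rewrite (zf u0 hu0) in e.
    assert (n0 : Derive f u0 ^ 2 <> 0).
    { intros z; apply hK; rewrite <- e, z; ring. }
    rewrite <- e; field; intros z; apply n0; rewrite z; ring. }
  pose proof (derive_sqr_const _ _ _ _ hI2 hg hg') as zg.
  destruct (second_derive_zero_affine _ _ _ hI1 hf zf) as [A [B hAB]].
  destruct (second_derive_zero_affine _ _ _ hI2 hg zg) as [C [D hCD]].
  exists A, B, C, D; repeat split.
  - rewrite <- (h u0 v0 hu0 hv0), (zf u0 hu0).
    destruct (hAB u0 hu0) as [-> _]; destruct (hCD v0 hv0) as [-> _]; ring.
  - intros u hu; apply (hAB u hu).
  - intros v hv; apply (hCD v hv).
Qed.

Theorem theorem3p1 (a K0 : R) (l1 r1 l2 r2 : Rbar) (f1 f2 : R -> R)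
  (ha : a <> 0)
  (hI1 : Rbar_lt l1 r1) (hI2 : Rbar_lt l2 r2)
  (hf1 : smooth_on (ointerval l1 r1) f1)
  (hf2 : smooth_on (ointerval l2 r2) f2) :
  let w := factorable1 a f1 f2 in
  let D := factorable1_dom a (ointerval l1 r1) (ointerval l2 r2) in
  (forall x y : R, D x y -> isotropic_curvature w x y = K0) ->
  exists c1 c2 c3 : R,
    ((forall x y : R, D x y -> w x y = c1 * f2 (y + a * x))
     \/ (forall x y : R, D x y -> w x y = c1 * f1 x))
    \/ (forall x y : R, D x y ->
          w x y = c1 * exp (c2 * x + c3 * (y + a * x)))
    \/ (c2 <> 1 /\
        exists phi psi : R -> R, line_isometry phi /\ line_isometry psi /\
          forall x y : R, D x y ->
            exists p q : R,
              is_rpow (phi x) (1 / (1 - c2)) p /\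
              is_rpow (psi (y + a * x)) (c2 / (c2 - 1)) q /\
              w x y = c1 * p * q)
    \/ (K0 <> 0 /\
        exists phi psi : R -> R, line_isometry phi /\ line_isometry psi /\
          forall x y : R, D x y ->
            w x y = sqrt (Rabs K0) * phi x * psi (y + a * x)).
Proof.
  intros w D hK.
  assert (H : forall u v, ointerval l1 r1 u -> ointerval l2 r2 v ->
     (f1 u * Derive (Derive f1) u) * (f2 v * Derive (Derive f2) v)
     - Derive f1 u ^ 2 * Derive f2 v ^ 2 = K0).
  { intros u v hu hv.
    assert (e : v - a * u + a * u = v) by ring.
    rewrite <- (hK u (v - a * u)).
    - unfold w; rewrite (factorable1_curvature a l1 r1 l2 r2); auto;
        rewrite e; auto.
    - split; [exact hu | rewrite e; exact hv]. }
  unfold w, D, factorable1, factorable1_dom.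
  destruct (Req_dec K0 0) as [K00 | K00].
  (* k = 1 for g as well when k = 1 for f; otherwise g has the exponent
     1 / (1 - 1/k) = k / (k - 1). *)
  - destruct (flat_separation l1 r1 l2 r2 f1 f2 hI1 hI2 hf1 hf2)
      as [[c hc] | [[c hc] | [k [k0 [of og]]]]].
    + intros u v hu hv; pose proof (H u v hu hv); lra.
    + exists c, 0, 0; left; left; intros x y [hx _]; now rewrite hc.
    + exists c, 0, 0; left; right; intros x y [_ hy]; rewrite hc; auto; ring.
    + destruct (Req_dec k 1) as [k1 | k1].
      * rewrite k1 in of, og; replace (1 / 1) with 1 in og by field.
        destruct (power_ode_exp _ _ _ hI1 hf1 of) as [c [al hc]].
        destruct (power_ode_exp _ _ _ hI2 hf2 og) as [d [be hd]].
        exists (c * d), al, be; right; left; intros x y [hx hy].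
        rewrite hc, hd, exp_plus; auto; ring.
      * assert (k1' : 1 / k <> 1).
        { intros e; apply k1.
          replace k with (1 / (1 / k)) by (field; exact k0); rewrite e; field. }
        destruct (power_ode_rpow _ _ _ _ hI1 hf1 of k1)
          as [[c hc] | [c [phi [hphi hc]]]].
        { exists c, 0, 0; left; left; intros x y [hx _]; now rewrite hc. }
        destruct (power_ode_rpow _ _ _ _ hI2 hf2 og k1')
          as [[d hd] | [d [psi [hpsi hd]]]].
        { exists d, 0, 0; left; right; intros x y [_ hy]; rewrite hd; auto; ring. }
        exists (c * d), k, 0; right; right; left; split; [exact k1 |].
        exists phi, psi; split; [exact hphi | split; [exact hpsi |]].
        intros x y [hx hy].
        destruct (hc x hx) as [p [hp ep]]; destruct (hd _ hy) as [q [hq eq]].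
        exists p, q; split; [exact hp | split].
        -- replace (k / (k - 1)) with (1 / (1 - 1 / k)); [exact hq |].
           field; repeat split; lra.
        -- rewrite ep, eq; ring.
  - destruct (curved_separation l1 r1 l2 r2 f1 f2 K0 hI1 hI2 hf1 hf2 H K00)
      as [A [B [C [E [e [hA hC]]]]]].
    assert (n : A * C <> 0) by (intros z; apply K00; rewrite <- e, z; ring).
    assert (nA : A <> 0) by (intros z; apply n; rewrite z; ring).
    assert (nC : C <> 0) by (intros z; apply n; rewrite z; ring).
    assert (sK : sqrt (Rabs K0) = Rabs (A * C)).
    { rewrite <- e, Rabs_Ropp, <- RPow_abs, <- Rsqr_pow2.
      apply sqrt_Rsqr, Rabs_pos. }
    assert (nAC : Rabs (A * C) <> 0) by now apply Rabs_no_R0.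
    exists 0, 0, 0; right; right; right; split; [exact K00 |].
    (* The sign of A C goes into the isometry psi. *)
    exists (fun t => 1 * t + B / A),
      (fun t => A * C / Rabs (A * C) * t + A * C / Rabs (A * C) * (E / C)).
    split; [exists 1, (B / A); auto | split].
    + exists (A * C / Rabs (A * C)), (A * C / Rabs (A * C) * (E / C)).
      split; [| reflexivity].
      unfold Rabs; destruct (Rcase_abs (A * C)); [right | left]; field; auto.
    + intros x y [hx hy]; rewrite (hA x hx), (hC _ hy), sK.
      field; auto.
Qed.
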